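(* For each $m,n\in\mathbb{N}$ (natural numbers, including $0$), the logic $\mathbf{N}^+\mathbf{A}_{m,n}$ is decidable, i.e. the set of formulae $\psi$ with $\mathbf{N}^+\mathbf{A}_{m,n}\vdash\psi$ is decidable.
   Context: Language: modal formulae are built from countably many propositional variables, the constant $\bot$, $\neg$, $\lor$, and $\Box$; $\varphi\to\psi$ abbreviates $\neg\varphi\lor\psi$. $\Box^0\varphi=\varphi$ and $\Box^{k+1}\varphi=\Box\Box^k\varphi$. Decidability refers to any standard effective coding of formulae. Logics: $\mathbf{N}$ has as axioms all propositional tautologies in the modal language and as rules modus ponens and necessitation (from $\varphi$ infer $\Box\varphi$). $\mathbf{N}\mathbf{A}_{m,n}$ is $\mathbf{N}$ plus the axiom scheme $\Box^n\varphi\to\Box^m\varphi$ (all formulae $\varphi$). $\mathbf{N}^+\mathbf{A}_{m,n}$ is $\mathbf{N}\mathbf{A}_{m,n}$ plus the rule $\mathrm{Ros}^\Box$: from $\neg\Box\varphi$ infer $\neg\Box\Box\varphi$. *)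

(* Defs.v *)
From mathcomp Require Import all_boot.

Set Implicit Arguments.
Unset Strict Implicit.
Unset Printing Implicit Defensive.

Inductive form : Type :=
| Var of nat
| Bot
| Neg of form
| Or of form & form
| Box of form.

Definition Imp (phi psi : form) : form := Or (Neg phi) psi.

Definition boxn (k : nat) (phi : form) : form := iter k Box phi.

(* Propositional evaluation of modal formulae: variables and boxed formulae are
   the propositional atoms, and v gives their truth values. *)
Fixpoint teval (v : form -> bool) (phi : form) : bool :=
  match phi with
  | Var _ => v phi
  | Bot => false
  | Neg psi => ~~ teval v psi
  | Or psi chi => teval v psi || teval v chi
  | Box _ => v phi
  end.

Definition tautology (phi : form) : Prop := forall v, teval v phi.

Inductive NplusA (m n : nat) : form -> Prop :=
| NplusA_taut phi : tautology phi -> NplusA m n phi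
| NplusA_acc phi : NplusA m n (Imp (boxn n phi) (boxn m phi))
| NplusA_mp phi psi :
    NplusA m n (Imp phi psi) -> NplusA m n phi -> NplusA m n psi
| NplusA_nec phi : NplusA m n phi -> NplusA m n (Box phi)
| NplusA_rosbox phi :
    NplusA m n (Neg (Box phi)) -> NplusA m n (Neg (Box (Box phi))).

(* Decidability is recursiveness of the set of codes: a Boolean-valued decision
   function in Rocq would not do, since under the classical and choice axioms
   every predicate has one. *)

Fixpoint primrec k (f : k.-tuple nat -> nat) (g : k.+2.-tuple nat -> nat)
    (n : nat) (v : k.-tuple nat) : nat :=
  if n is n'.+1 then g [tuple of n' :: primrec f g n' v :: v] else f v.

(* The total recursive functions: the least class of total functions containing
   the initial functions and closed under composition, primitive recursion and
   minimization of regular functions.  In [rec_mu], the existence of g says that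
   f is regular. *)
Inductive recursive : forall k, (k.-tuple nat -> nat) -> Prop :=
| rec_zero k : @recursive k (fun=> 0)
| rec_succ : @recursive 1 (fun v => (thead v).+1)
| rec_proj k (i : 'I_k) : @recursive k (fun v => tnth v i)
| rec_comp k l (f : l.-tuple nat -> nat) (g : 'I_l -> k.-tuple nat -> nat) :
    recursive f -> (forall i, recursive (g i)) ->
    @recursive k (fun v => f [tuple g i v | i < l])
| rec_prec k (f : k.-tuple nat -> nat) (g : k.+2.-tuple nat -> nat) :
    recursive f -> recursive g ->
    @recursive k.+1 (fun v => primrec f g (thead v) [tuple of behead v])
| rec_mu k (f : k.+1.-tuple nat -> nat) (g : k.-tuple nat -> nat) :
    recursive f ->
    (forall v, f [tuple of g v :: v] = 0) ->
    (forall v y, y < g v -> f [tuple of y :: v] <> 0) ->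
    recursive g.

Definition recursive_set (A : nat -> Prop) : Prop :=
  exists2 chi : 1.-tuple nat -> nat, recursive chi &
    forall x, (A x -> chi [tuple x] = 1) /\ (~ A x -> chi [tuple x] = 0).

(* Cantor pairing: (x + y) * (x + y + 1) / 2 + y. *)
Definition cpair (x y : nat) : nat := 'C((x + y).+1, 2) + y.

Fixpoint code (phi : form) : nat :=
  match phi with
  | Bot => 0
  | Var i => (4 * i).+1
  | Neg psi => (4 * code psi).+2
  | Or psi chi => (4 * cpair (code psi) (code chi)).+3
  | Box psi => (4 * code psi).+4
  end.

Definition decidable_set (P : form -> Prop) : Prop :=
  recursive_set (fun x => exists2 psi, code psi = x & P psi).

Lemma cpair_inj x y x' y' : cpair x y = cpair x' y' -> x = x' /\ y = y'.
Proof.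
have lt_cpair a b a' b' : a + b < a' + b' -> cpair a b < cpair a' b'.
  move=> lt_ab; rewrite /cpair (leq_trans _ (leq_addr _ _)) //.
  rewrite (@leq_trans 'C((a + b).+2, 2)) ?leq_bin2l //.
  by rewrite [X in _ < X]binS bin1 ltn_add2l ltnS leq_addl.
move=> eq_p; have eq_s : x + y = x' + y'.
  by case: (ltngtP (x + y) (x' + y')) => // /lt_cpair; rewrite eq_p ltnn.
move: eq_p; rewrite /cpair eq_s => /addnI eq_y; split=> //.
by move: eq_s; rewrite eq_y => /addIn.
Qed.

Lemma code_inj : injective code.
Proof.
have eq4 a b r s : r < 4 -> s < 4 -> 4 * a + r = 4 * b + s -> a = b /\ r = s.
  move=> lt_r lt_s eq_ab; have := congr1 (modn^~ 4) eq_ab.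
  rewrite /= ![4 * _]mulnC !modnMDl !modn_small // => eq_rs.
  split=> //; move: eq_ab; rewrite eq_rs => /addIn/eqP.
  by rewrite eqn_pmul2l // => /eqP.
elim=> [i||p IHp|p IHp q IHq|p IHp] [j||p'|p' q'|p'] //= [] eq_c.
- by have [] := eq4 i j 0 0 isT isT; rewrite ?addn0 // => ->.
- by have [] := eq4 i (code p') 0 1 isT isT; rewrite ?addn0 ?addn1.
- by have [] := eq4 i (cpair (code p') (code q')) 0 2 isT isT;
    rewrite ?addn0 ?addn2.
- by have [] := eq4 i (code p') 0 3 isT isT; rewrite ?addn0 ?addn3.
- by have [] := eq4 (code p) j 1 0 isT isT; rewrite ?addn0 ?addn1.
- by have [] := eq4 (code p) (code p') 0 0 isT isT; rewrite ?addn0 // => /IHp->.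
- by have [] := eq4 (code p) (cpair (code p') (code q')) 0 1 isT isT;
    rewrite ?addn0 ?addn1.
- by have [] := eq4 (code p) (code p') 0 2 isT isT; rewrite ?addn0 ?addn2.
- by have [] := eq4 (cpair (code p) (code q)) j 2 0 isT isT;
    rewrite ?addn0 ?addn2.
- by have [] := eq4 (cpair (code p) (code q)) (code p') 1 0 isT isT;
    rewrite ?addn0 ?addn1.
- have [] := eq4 (cpair (code p) (code q)) (cpair (code p') (code q')) 0 0
               isT isT; rewrite ?addn0 //.
  by move=> /cpair_inj[/IHp-> /IHq->].
- by have [] := eq4 (cpair (code p) (code q)) (code p') 0 1 isT isT;
    rewrite ?addn0 ?addn1.
- by have [] := eq4 (code p) j 3 0 isT isT; rewrite ?addn0 ?addn3.
- by have [] := eq4 (code p) (code p') 2 0 isT isT; rewrite ?addn0 ?addn2.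
- by have [] := eq4 (code p) (cpair (code p') (code q')) 1 0 isT isT;
    rewrite ?addn0 ?addn1.
- by have [] := eq4 (code p) (code p') 0 0 isT isT; rewrite ?addn0 // => /IHp->.
Qed.

(* Main.v *)
Require Import Defs.
From mathcomp Require Import all_boot.
From Stdlib Require Import Classical FunctionalExtensionality.

(* Formulas are identified with their codes, which exhaust nat, so the formulas
   of code at most x form a finite fragment closed under subformulas.  A formula
   of code x is unprovable iff it fails in some finite set of valuations of this
   fragment that respects the axioms and rules inside the fragment together with
   two derived rules on chains of boxes: if n < m and ~[]^k A is valid for some
   k > 0, so is ~[]^j A for all j >= n; if m < n and []^k A is valid, so is []^j A
   for all j >= m.  These derived rules are exactly what is needed to extend such
   a set to all formulas, and the set of all consistent valuations of the fragment
   satisfies them.  There are at most 2^(2^(x+1)) sets to try. *)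

Set Implicit Arguments.
Unset Strict Implicit.
Unset Printing Implicit Defensive.

(** * Recursive functions *)

(** The constructors of [recursive] fix the shape of the function; extensionality frees the later
    closure lemmas from it. *)
Lemma recursive_ext k (f g : k.-tuple nat -> nat) :
  recursive f -> f =1 g -> recursive g.
Proof. by move=> rec_f /functional_extensionality <-. Qed.

Lemma rec_head k : recursive (fun v : k.+1.-tuple nat => thead v).
Proof. exact: rec_proj ord0. Qed.

(** Weakening, by shifted projections: for use under a quantifier or recursion that puts a new
    variable in front. *)
Lemma rec_tail k (F : k.-tuple nat -> nat) :
  recursive F -> recursive (fun v : k.+1.-tuple nat => F [tuple of behead v]).
Proof.
move=> rec_F.
apply: recursive_ext (rec_comp rec_F (fun i => rec_proj (lift ord0 i))) _ => v.
congr F; apply: eq_from_tnth => i; rewrite tnth_mktuple tnth_behead.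
by congr tnth; apply: val_inj; rewrite /= inordK // ltnS.
Qed.

Lemma rec_S k (F : k.-tuple nat -> nat) :
  recursive F -> recursive (fun v => (F v).+1).
Proof.
move=> rec_F.
apply: recursive_ext (rec_comp rec_succ (fun=> rec_F)) _ => v.
by rewrite /thead tnth_mktuple.
Qed.

Lemma rec_const k c : recursive (fun _ : k.-tuple nat => c).
Proof. by elim: c => [|c IHc]; [exact: rec_zero | exact: rec_S]. Qed.

Lemma rec_iteri k (N F : k.-tuple nat -> nat)
    (G : nat -> nat -> k.-tuple nat -> nat) :
  recursive N -> recursive F ->
  recursive (fun v : k.+2.-tuple nat =>
    G (thead v) (thead [tuple of behead v])
      [tuple of behead [tuple of behead v]]) ->
  recursive (fun v => iteri (N v) (fun i acc => G i acc v) (F v)).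
Proof.
move=> rec_N rec_F rec_G.
(* [rec_prec] recurses on the head of its tuple, so [args] builds the tuple [N v :: v]. *)
pose args (i : 'I_k.+1) : k.-tuple nat -> nat :=
  if unlift ord0 i is Some j then fun v => tnth v j else N.
have rec_args i : recursive (args i).
  by rewrite /args; case: unlift => [j|//]; apply: rec_proj.
apply: recursive_ext (rec_comp (rec_prec rec_F rec_G) rec_args) _ => v.
have -> : [tuple args i v | i < k.+1] = [tuple of N v :: v].
  apply: eq_from_tnth => i; rewrite tnth_mktuple /args.
  by case: unliftP => [j|] ->; rewrite ?tnthS ?tnth0.
have -> : [tuple of behead [tuple of N v :: v]] = v by apply: val_inj.
rewrite theadE; elim: (N v) => //= i ->.
by rewrite !theadE; congr (G _ _ _); apply: val_inj.
Qed.

Lemma rec_iter k (N F : k.-tuple nat -> nat) (h : nat -> nat) :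
  recursive N -> recursive F ->
  (forall l (H : l.-tuple nat -> nat),
     recursive H -> recursive (fun v => h (H v))) ->
  recursive (fun v => iter (N v) h (F v)).
Proof.
move=> rec_N rec_F rec_h.
have rec_body := rec_h _ _ (rec_tail (rec_head k)).
have rec_it := @rec_iteri k N F (fun _ acc _ => h acc) rec_N rec_F rec_body.
by apply: recursive_ext rec_it _ => v /=; elim: (N v) => //= i ->.
Qed.

Lemma rec_add k (F G : k.-tuple nat -> nat) :
  recursive F -> recursive G -> recursive (fun v => F v + G v).
Proof.
move=> rec_F rec_G.
apply: recursive_ext (rec_iter rec_G rec_F rec_S) _ => v.
by rewrite iter_succn addnC.
Qed.

Lemma rec_pred k (F : k.-tuple nat -> nat) :
  recursive F -> recursive (fun v => (F v).-1).
Proof.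
move=> rec_F.
(* The iteration forgets its accumulator and returns the last counter, or 0 if there is no step. *)
have := @rec_iteri k F (fun=> 0) (fun i _ _ => i) rec_F (rec_const _ _).
move=> /(_ (rec_head _)) rec_it.
by apply: recursive_ext rec_it _ => v /=; case: (F v).
Qed.

Section Arithmetic.

Variables (k : nat) (F G : k.-tuple nat -> nat).
Hypotheses (rec_F : recursive F) (rec_G : recursive G).

Lemma rec_sub : recursive (fun v => F v - G v).
Proof.
apply: recursive_ext (rec_iter rec_G rec_F rec_pred) _ => v.
by elim: (G v) => [|i /= ->]; rewrite ?subn0 ?subnS.
Qed.

Lemma rec_mul : recursive (fun v => F v * G v).
Proof.
have := @rec_iteri k F (fun=> 0) (fun _ acc v => acc + G v) rec_F (rec_const _ _).
move=> /(_ (rec_add (rec_tail (rec_head _)) (rec_tail (rec_tail rec_G)))).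
move=> rec_it; apply: recursive_ext rec_it _ => v /=.
by elim: (F v) => //= i ->; rewrite mulSn addnC.
Qed.

Lemma rec_odd : recursive (fun v => odd (F v)).
Proof.
have rec_flip l (H : l.-tuple nat -> nat) :
  recursive H -> recursive (fun v => 1 - H v).
  have := @rec_iteri l H (fun=> 1) (fun _ _ _ => 0) => rec_it rec_H.
  apply: recursive_ext (rec_it rec_H (rec_const _ _) (rec_const _ _)) _ => v.
  by case: (H v).
apply: recursive_ext (rec_iter rec_F (rec_const _ 0) rec_flip) _ => v.
by elim: (F v) => //= i ->; case: odd.
Qed.

End Arithmetic.

(** By the recurrence [i.+1./2 = odd i + i./2]. *)
Lemma rec_half k (F : k.-tuple nat -> nat) :
  recursive F -> recursive (fun v => (F v)./2).
Proof.
move=> rec_F.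
have := @rec_iteri k F (fun=> 0) (fun i acc _ => odd i + acc) rec_F.
move=> /(_ (rec_const _ _)).
move=> /(_ (rec_add (rec_odd (rec_head _)) (rec_tail (rec_head _)))) rec_it.
apply: recursive_ext rec_it _ => v /=.
by elim: (F v) => //= i ->; rewrite uphalf_half.
Qed.

Lemma rec_exp2 k (F : k.-tuple nat -> nat) :
  recursive F -> recursive (fun v => 2 ^ F v).
Proof.
move=> rec_F.
have rec_dbl l (H : l.-tuple nat -> nat) :
  recursive H -> recursive (fun v => 2 * H v).
  by move=> rec_H; apply: rec_mul => //; apply: rec_const.
apply: recursive_ext (rec_iter rec_F (rec_const _ 1) rec_dbl) _ => v.
by elim: (F v) => //= i ->; rewrite expnS.
Qed.

Lemma rec_cpair k (F G : k.-tuple nat -> nat) :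
  recursive F -> recursive G -> recursive (fun v => cpair (F v) (G v)).
Proof.
move=> rec_F rec_G; have rec_FG := rec_add rec_F rec_G.
apply: recursive_ext (rec_add (rec_half (rec_mul (rec_S rec_FG) rec_FG)) rec_G) _.
by move=> v; rewrite /cpair bin2.
Qed.

(** * Recursive predicates, bounded quantifiers and binary digits *)

Section Predicates.

Variable k : nat.

Lemma rec_leq (F G : k.-tuple nat -> nat) :
  recursive F -> recursive G -> recursive (fun v => F v <= G v).
Proof.
move=> rec_F rec_G.
apply: recursive_ext (rec_sub (rec_const _ 1) (rec_sub rec_F rec_G)) _ => v.
by rewrite /leq; case: (F v - G v).
Qed.

Variables P Q : k.-tuple nat -> bool.
Hypotheses (rec_P : recursive (fun v => P v)) (rec_Q : recursive (fun v => Q v)).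

Lemma rec_andb : recursive (fun v => P v && Q v).
Proof. by apply: recursive_ext (rec_mul rec_P rec_Q) _ => v; rewrite mulnb. Qed.

Lemma rec_negb : recursive (fun v => ~~ P v).
Proof.
apply: recursive_ext (rec_sub (rec_const _ 1) rec_P) _ => v.
by case: (P v).
Qed.

Lemma rec_implb : recursive (fun v => P v ==> Q v).
Proof.
by apply: recursive_ext (rec_leq rec_P rec_Q) _ => v; case: (P v); case: (Q v).
Qed.

End Predicates.

Lemma rec_orb k (P Q : k.-tuple nat -> bool) :
  recursive (fun v => P v) -> recursive (fun v => Q v) ->
  recursive (fun v => P v || Q v).
Proof.
move=> rec_P rec_Q; apply: recursive_ext (rec_implb (rec_negb rec_P) rec_Q) _.
by move=> v; case: (P v).
Qed.

Lemma rec_eqb k (P Q : k.-tuple nat -> bool) :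
  recursive (fun v => P v) -> recursive (fun v => Q v) ->
  recursive (fun v => P v == Q v).
Proof.
move=> rec_P rec_Q.
apply: recursive_ext (rec_andb (rec_implb rec_P rec_Q) (rec_implb rec_Q rec_P)) _.
by move=> v; case: (P v); case: (Q v).
Qed.

Definition bforall N (P : pred nat) := all P (iota 0 N).

Lemma bforallP N (P : pred nat) :
  reflect (forall i, i < N -> P i) (bforall N P).
Proof.
apply: (iffP allP) => PN i; first by move=> lt_i; apply: PN; rewrite mem_iota.
by rewrite mem_iota => /PN.
Qed.

(** A bounded quantifier is the product of its truth values, read as 0 and 1. *)
Lemma rec_bforall k (N : k.-tuple nat -> nat) (P : nat -> k.-tuple nat -> bool) :
  recursive N ->
  recursive (fun v : k.+1.-tuple nat => P (thead v) [tuple of behead v]) ->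
  recursive (fun v => bforall (N v) (fun i => P i v)).
Proof.
move=> rec_N rec_P.
have rec_acc : recursive (fun v : k.+2.-tuple nat =>
    thead [tuple of behead v] *
    P (thead v) [tuple of behead [tuple of behead v]]).
  apply: rec_mul; first exact: rec_tail (rec_head _).
  (* Position 0 holds the counter and position 1 the accumulator; [skip] omits the latter. *)
  pose skip (i : 'I_k.+1) : 'I_k.+2 :=
    if unlift ord0 i is Some j then lift ord0 (lift ord0 j) else ord0.
  apply: recursive_ext (rec_comp rec_P (fun i => rec_proj (skip i))) _ => v.
  have -> : [tuple tnth v (skip i) | i < k.+1] =
      [tuple of thead v :: behead [tuple of behead v]].
    apply: eq_from_tnth => i; rewrite tnth_mktuple /skip.
    case: unliftP => [j|] ->; rewrite ?tnth0 // tnthS.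
    rewrite !tnth_behead; congr tnth; apply: val_inj.
    by rewrite /= !inordK ?bump0 ?ltnS.
  by rewrite theadE; congr (nat_of_bool (P _ _)); apply: val_inj.
have := @rec_iteri k N (fun=> 1) (fun i acc v => acc * P i v) rec_N (rec_const _ _).
move=> /(_ rec_acc) rec_it; apply: recursive_ext rec_it _ => v /=.
rewrite /bforall; elim: (N v) => // i IHi.
by rewrite -[in RHS]addn1 iotaD all_cat /= IHi andbT mulnb.
Qed.

(** Binary digit [a] of [u]: numbers thus code finite sets and valuations. *)
Definition bit u a := odd (iter a half u).

Lemma rec_bit k (F G : k.-tuple nat -> nat) :
  recursive F -> recursive G -> recursive (fun v => bit (F v) (G v)).
Proof. by move=> rec_F rec_G; apply/rec_odd/(rec_iter rec_G rec_F)/rec_half. Qed.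

(** [P] is arbitrary, as only the existence of a code matters: excluded middle gives the lowest
    digit, induction on the shifted predicate the others. *)
Lemma bits_exist (P : nat -> Prop) N :
  exists2 u, u < 2 ^ N & forall a, a < N -> bit u a <-> P a.
Proof.
elim: N P => [|N IHN] P; first by exists 0.
have [u lt_u bit_u] := IHN (fun a => P a.+1).
have [b Pb] : exists b : bool, b <-> P 0.
  by case: (classic (P 0)) => P0; [exists true | exists false].
exists (b + u.*2) => [|[|a] lt_a].
- by rewrite expnS mul2n -ltn_half_double half_bit_double.
- by rewrite /bit /= oddD odd_double addbF oddb.
- by rewrite /bit iterSr half_bit_double; apply: bit_u.
Qed.

(** * Finite models *)

(* A finite model is coded by numbers [x] and [w]: the worlds are the [u] with
   [bit w u], and [bit u a] is the truth value at [u] of the formula of code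
   [a], for [a <= x]. *)
Definition all_worlds x w (P : pred nat) :=
  bforall (2 ^ x.+1) (fun u => bit w u ==> P u).

Definition valid x w a := all_worlds x w (fun u => bit u a).
Definition null x w a := all_worlds x w (fun u => ~~ bit u a).

Definition cneg a := (4 * a).+2.
Definition cor a b := (4 * cpair a b).+3.
Definition cbox a := (4 * a).+4.

(** 0 is the code of [Bot]. Variables and boxes are propositional atoms, hence unconstrained. *)
Definition coherent x u :=
  [&& ~~ bit u 0,
      bforall x.+1 (fun a => (cneg a <= x) ==> (bit u (cneg a) == ~~ bit u a)) &
      bforall x.+1 (fun a => bforall x.+1 (fun b =>
        (cor a b <= x) ==> (bit u (cor a b) == bit u a || bit u b)))].

Definition acc_at m n x u := bforall x.+1 (fun a =>
  (iter m cbox a <= x) ==> (iter n cbox a <= x) ==>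
  bit u (iter n cbox a) ==> bit u (iter m cbox a)).

Definition nec_closed x w := bforall x.+1 (fun a =>
  (cbox a <= x) ==> valid x w a ==> valid x w (cbox a)).

Definition ros_closed x w := bforall x.+1 (fun a =>
  (cbox (cbox a) <= x) ==> null x w (cbox a) ==> null x w (cbox (cbox a))).

(** Only j < k is listed, which forces k > 0; the ascending direction is [ros_closed] iterated.
    Bounding k by x loses nothing, since [iter k cbox a] is at least k. *)
Definition null_closed n x w := bforall x.+1 (fun a =>
  bforall x.+1 (fun k => bforall k (fun j =>
    (n <= j) ==> (iter k cbox a <= x) ==>
    null x w (iter k cbox a) ==> null x w (iter j cbox a)))).

Definition valid_closed m x w := bforall x.+1 (fun a =>
  bforall x.+1 (fun k => bforall k (fun j =>
    (m <= j) ==> (iter k cbox a <= x) ==>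
    valid x w (iter k cbox a) ==> valid x w (iter j cbox a)))).

Definition model m n x w :=
  [&& all_worlds x w (fun u => coherent x u && acc_at m n x u),
      nec_closed x w, ros_closed x w,
      (n < m) ==> null_closed n x w & (m < n) ==> valid_closed m x w].

(** Valuations of the codes up to x are numbers below 2^(x+1), so sets of them are coded below
    2^(2^(x+1)). The empty set validates everything and refutes nothing. *)
Definition refuted m n x :=
  ~~ bforall (2 ^ (2 ^ x.+1)) (fun w => model m n x w ==> valid x w x).

(** * Recursiveness of the search for finite models *)

Section RecursiveModels.

Variables (k : nat) (X W A : k.-tuple nat -> nat).
Hypotheses (rec_X : recursive X) (rec_W : recursive W) (rec_A : recursive A).

Lemma rec_cbox : recursive (fun v => cbox (A v)).
Proof. by do 4!apply: rec_S; apply: rec_mul => //; apply: rec_const. Qed.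

Lemma rec_cneg : recursive (fun v => cneg (A v)).
Proof. by do 2!apply: rec_S; apply: rec_mul => //; apply: rec_const. Qed.

Lemma rec_all_worlds (P : nat -> k.-tuple nat -> bool) :
  recursive (fun v : k.+1.-tuple nat => P (thead v) [tuple of behead v]) ->
  recursive (fun v => all_worlds (X v) (W v) (fun u => P u v)).
Proof.
move=> rec_P.
apply: (@rec_bforall k _ (fun u v => bit (W v) u ==> P u v)).
  exact: rec_exp2 (rec_S rec_X).
apply: rec_implb rec_P; apply: rec_bit (rec_head _); exact: rec_tail.
Qed.

End RecursiveModels.

Lemma rec_valid k (X W A : k.-tuple nat -> nat) :
  recursive X -> recursive W -> recursive A ->
  recursive (fun v => valid (X v) (W v) (A v)).
Proof.
move=> rec_X rec_W rec_A.
apply: (@rec_all_worlds k X W rec_X rec_W (fun u v => bit u (A v))).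
exact: rec_bit (rec_head _) (rec_tail rec_A).
Qed.

Lemma rec_null k (X W A : k.-tuple nat -> nat) :
  recursive X -> recursive W -> recursive A ->
  recursive (fun v => null (X v) (W v) (A v)).
Proof.
move=> rec_X rec_W rec_A.
apply: (@rec_all_worlds k X W rec_X rec_W (fun u v => ~~ bit u (A v))).
apply: rec_negb; exact: rec_bit (rec_head _) (rec_tail rec_A).
Qed.

Lemma rec_iter_cbox k (J A : k.-tuple nat -> nat) :
  recursive J -> recursive A -> recursive (fun v => iter (J v) cbox (A v)).
Proof.
by move=> rec_J rec_A; apply: rec_iter rec_J rec_A _ => l H; apply: rec_cbox.
Qed.

Lemma rec_coherent k (X U : k.-tuple nat -> nat) :
  recursive X -> recursive U -> recursive (fun v => coherent (X v) (U v)).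
Proof.
move=> rec_X rec_U; have rec_X1 := rec_S rec_X.
apply: rec_andb; first exact: rec_negb (rec_bit rec_U (rec_const _ _)).
apply: rec_andb.
  apply: (@rec_bforall k (fun v => (X v).+1) (fun a v => (cneg a <= X v) ==>
    (bit (U v) (cneg a) == ~~ bit (U v) a))) => //.
  have [rec_X' rec_U'] := (rec_tail rec_X, rec_tail rec_U).
  have [rec_a rec_na] := (rec_head k, rec_cneg (rec_head k)).
  apply: rec_implb (rec_leq rec_na rec_X') _.
  exact: rec_eqb (rec_bit _ _) (rec_negb (rec_bit _ _)).
apply: (@rec_bforall k (fun v => (X v).+1) (fun a v => bforall (X v).+1 (fun b =>
  (cor a b <= X v) ==> (bit (U v) (cor a b) == bit (U v) a || bit (U v) b)))) => //.
have rec_X1' := rec_tail rec_X1.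
apply: (@rec_bforall k.+1 _ (fun b v => (cor (thead v) b <= X [tuple of behead v]) ==>
  (bit (U [tuple of behead v]) (cor (thead v) b) ==
    bit (U [tuple of behead v]) (thead v) || bit (U [tuple of behead v]) b))) => //.
have rec_X' := rec_tail (rec_tail rec_X).
have rec_U' := rec_tail (rec_tail rec_U).
have rec_b := rec_head k.+1; have rec_a := rec_tail (rec_head k).
have rec_or : recursive (fun v : k.+2.-tuple nat =>
    cor (thead [tuple of behead v]) (thead v)).
  by do 3!apply: rec_S; apply: rec_mul (rec_const _ _) (rec_cpair _ _).
apply: rec_implb (rec_leq rec_or rec_X') _.
exact: rec_eqb (rec_bit _ _) (rec_orb (rec_bit _ _) (rec_bit _ _)).
Qed.

Lemma rec_acc_at m n k (X U : k.-tuple nat -> nat) :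
  recursive X -> recursive U -> recursive (fun v => acc_at m n (X v) (U v)).
Proof.
move=> rec_X rec_U; have rec_X1 := rec_S rec_X.
apply: (@rec_bforall k (fun v => (X v).+1) (fun a v =>
  (iter m cbox a <= X v) ==> (iter n cbox a <= X v) ==>
  bit (U v) (iter n cbox a) ==> bit (U v) (iter m cbox a))) => //.
have [rec_X' rec_U'] := (rec_tail rec_X, rec_tail rec_U).
have rec_m := rec_iter_cbox (rec_const _ m) (rec_head k).
have rec_n := rec_iter_cbox (rec_const _ n) (rec_head k).
apply: rec_implb (rec_leq rec_m rec_X') _.
apply: rec_implb (rec_leq rec_n rec_X') _.
exact: rec_implb (rec_bit _ _) (rec_bit _ _).
Qed.

Section RecursiveClosure.

Variables (k : nat) (X W : k.-tuple nat -> nat).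
Hypotheses (rec_X : recursive X) (rec_W : recursive W).

Lemma rec_nec_closed : recursive (fun v => nec_closed (X v) (W v)).
Proof.
have rec_X1 := rec_S rec_X.
apply: (@rec_bforall k (fun v => (X v).+1) (fun a v =>
  (cbox a <= X v) ==> valid (X v) (W v) a ==> valid (X v) (W v) (cbox a))) => //.
have [rec_X' rec_W'] := (rec_tail rec_X, rec_tail rec_W).
have [rec_a rec_ba] := (rec_head k, rec_cbox (rec_head k)).
apply: rec_implb (rec_leq rec_ba rec_X') _.
exact: rec_implb (rec_valid _ _ _) (rec_valid _ _ _).
Qed.

Lemma rec_ros_closed : recursive (fun v => ros_closed (X v) (W v)).
Proof.
have rec_X1 := rec_S rec_X.
apply: (@rec_bforall k (fun v => (X v).+1) (fun a v =>
  (cbox (cbox a) <= X v) ==> null (X v) (W v) (cbox a) ==>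
  null (X v) (W v) (cbox (cbox a)))) => //.
have [rec_X' rec_W'] := (rec_tail rec_X, rec_tail rec_W).
have rec_ba := rec_cbox (rec_head k); have rec_bba := rec_cbox rec_ba.
apply: rec_implb (rec_leq rec_bba rec_X') _.
exact: rec_implb (rec_null _ _ _) (rec_null _ _ _).
Qed.

(** Serves both [null_closed] and [valid_closed], with [S] for [null] or [valid] and [d] for [n] or
    [m]. *)
Lemma rec_chain_closed d (S : nat -> nat -> nat -> bool) :
  (forall l (X' W' A : l.-tuple nat -> nat),
     recursive X' -> recursive W' -> recursive A ->
     recursive (fun v => S (X' v) (W' v) (A v))) ->
  recursive (fun v => bforall (X v).+1 (fun a =>
    bforall (X v).+1 (fun k => bforall k (fun j =>
      (d <= j) ==> (iter k cbox a <= X v) ==>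
      S (X v) (W v) (iter k cbox a) ==> S (X v) (W v) (iter j cbox a))))).
Proof.
move=> rec_Q; have rec_X1 := rec_S rec_X.
pose body x w a k j :=
  [==> d <= j, iter k cbox a <= x, S x w (iter k cbox a) => S x w (iter j cbox a)].
apply: (@rec_bforall k (fun v => (X v).+1) (fun a v =>
  bforall (X v).+1 (fun k => bforall k (body (X v) (W v) a k)))) => //.
apply: (@rec_bforall k.+1 (fun v => (X [tuple of behead v]).+1) (fun i v =>
  bforall i (body (X [tuple of behead v]) (W [tuple of behead v]) (thead v) i))).
  exact: rec_tail rec_X1.
apply: (@rec_bforall k.+2 (fun v => thead v) (fun j v =>
  body (X [tuple of behead [tuple of behead v]])
    (W [tuple of behead [tuple of behead v]])
    (thead [tuple of behead v]) (thead v) j)); first exact: rec_head.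
have rec_X' := rec_tail (rec_tail (rec_tail rec_X)).
have rec_W' := rec_tail (rec_tail (rec_tail rec_W)).
have rec_j := rec_head k.+2; have rec_k := rec_tail (rec_head k.+1).
have rec_a := rec_tail (rec_tail (rec_head k)).
have rec_ka := rec_iter_cbox rec_k rec_a.
have rec_ja := rec_iter_cbox rec_j rec_a.
apply: rec_implb (rec_leq (rec_const _ d) rec_j) _.
apply: rec_implb (rec_leq rec_ka rec_X') _.
exact: rec_implb (rec_Q _ _ _ _ _ _ _) (rec_Q _ _ _ _ _ _ _).
Qed.

Lemma rec_model m n : recursive (fun v => model m n (X v) (W v)).
Proof.
apply: rec_andb.
  apply: (@rec_all_worlds k X W rec_X rec_W
    (fun u v => coherent (X v) u && acc_at m n (X v) u)).
  have [rec_X' rec_u] := (rec_tail rec_X, rec_head k).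
  exact: rec_andb (rec_coherent _ _) (rec_acc_at _ _ _ _).
apply: rec_andb rec_nec_closed _; apply: rec_andb rec_ros_closed _.
apply: rec_andb.
  apply: (@rec_implb k (fun=> n < m)); first exact: rec_const.
  exact: (rec_chain_closed _ rec_null).
apply: (@rec_implb k (fun=> m < n)); first exact: rec_const.
exact: (rec_chain_closed _ rec_valid).
Qed.

End RecursiveClosure.

Lemma rec_refuted m n k (X : k.-tuple nat -> nat) :
  recursive X -> recursive (fun v => refuted m n (X v)).
Proof.
move=> rec_X; apply: rec_negb.
apply: (@rec_bforall k (fun v => 2 ^ (2 ^ (X v).+1)) (fun w v =>
  model m n (X v) w ==> valid (X v) w (X v))).
  exact: rec_exp2 (rec_exp2 (rec_S rec_X)).
have [rec_X' rec_w] := (rec_tail rec_X, rec_head k).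
exact: rec_implb (rec_model _ _ _ _) (rec_valid _ _ _).
Qed.

Lemma all_worldsP x w (P : pred nat) :
  reflect (forall u, u < 2 ^ x.+1 -> bit w u -> P u) (all_worlds x w P).
Proof.
by apply: (iffP (bforallP _ _)) => wP u lt_u; apply/implyP; apply: wP.
Qed.

(** * Bijectivity of the coding *)

(** Walks along the antidiagonals: (x, y+1) follows (x+1, y), and (y+1, 0) follows (0, y). *)
Lemma cpair_surj p : {xy | cpair xy.1 xy.2 = p}.
Proof.
elim: p => [|p [[[|x] y] /= <-]]; first by exists (0, 0).
- exists (y.+1, 0).
  by rewrite /cpair /= !add0n !addn0 binS bin1 addnS.
- exists (x, y.+1).
  by rewrite /cpair /= addnS addSn addnS.
Qed.

Lemma leq_cpair x y : x <= cpair x y /\ y <= cpair x y.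
Proof.
split; last exact: leq_addl.
by rewrite /cpair binS bin1 -!addnA addnCA leq_addr.
Qed.

(** For a > 0, the remainder of a - 1 modulo 4 names the constructor and the quotient codes its
    arguments. *)
Lemma code_surj a : {phi | code phi = a}.
Proof.
have [N lt_aN] := ubnP a; elim: N a lt_aN => // N IHN a lt_aN.
case: a lt_aN => [|a] lt_aN; first by exists Bot.
have lt_q q : q <= a %/ 4 -> q < N.
  move=> le_q; rewrite -ltnS; apply: leq_trans lt_aN.
  by rewrite !ltnS (leq_trans le_q) ?leq_div.
have def_a := divn_eq a 4; have := ltn_pmod a (isT : 0 < 4).
case: (a %% 4) def_a => [|[|[|[|//]]]] -> _.
- by exists (Var (a %/ 4)); rewrite /= mulnC addn0.
- have [p def_p] := IHN _ (lt_q _ (leqnn _)).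
  by exists (Neg p); rewrite /= def_p mulnC addn1.
- have [[b c] /= def_bc] := cpair_surj (a %/ 4).
  have [le_b le_c] := leq_cpair b c; rewrite def_bc in le_b le_c.
  have [[p def_p] [q def_q]] := (IHN _ (lt_q _ le_b), IHN _ (lt_q _ le_c)).
  by exists (Or p q); rewrite /= def_p def_q def_bc mulnC addn2.
- have [p def_p] := IHN _ (lt_q _ (leqnn _)).
  by exists (Box p); rewrite /= def_p mulnC addn3.
Qed.

Lemma code_boxn k phi : code (boxn k phi) = iter k cbox (code phi).
Proof. by elim: k => //= k ->. Qed.

Lemma leq_cbox a : a <= cbox a.
Proof. by do 4!apply: leqW; apply: leq_pmull. Qed.

Lemma leq_iter_cbox a j k : j <= k -> iter j cbox a <= iter k cbox a.
Proof.
elim: k => [|k IHk]; first by rewrite leqn0 => /eqP->.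
by rewrite leq_eqVlt ltnS => /predU1P[->//|/IHk le_jk]; apply: leq_trans (leq_cbox _).
Qed.

Lemma geq_iter_cbox a k : k <= iter k cbox a.
Proof.
elim: k => //= k IHk; apply: leq_ltn_trans IHk _.
by do 3!apply: leqW; apply: leq_pmull.
Qed.

(** * Soundness of finite models *)

(** Ros makes the box of a null formula null only when that formula is itself a box. *)
Definition is_box phi := if phi is Box _ then true else false.

Section Soundness.

Variables m n x w : nat.
Hypothesis model_w : model m n x w.

(* Outside the fragment [code phi <= x], a box is as true as possible when
   [n <= m], and as false as possible when [m < n]. *)
Fixpoint ext phi : pred nat := fun u =>
  if code phi <= x then bit u (code phi) else
  match phi with
  | Var _ | Bot => false
  | Neg p => ~~ ext p u
  | Or p q => ext p u || ext q u
  | Box p =>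
      if n <= m then ~~ (is_box p && all_worlds x w (fun u => ~~ ext p u))
      else all_worlds x w (ext p)
  end.

Notation ext_valid p := (all_worlds x w (ext p)).
Notation ext_null p := (all_worlds x w (fun u => ~~ ext p u)).

Lemma ext_in p u : code p <= x -> ext p u = bit u (code p).
Proof. by case: p => [i||p|p q|p] px; rewrite /= ?px. Qed.

Lemma ext_valid_in p : code p <= x -> ext_valid p = valid x w (code p).
Proof. by move=> px; apply: eq_all => u; rewrite ext_in. Qed.

Lemma ext_null_in p : code p <= x -> ext_null p = null x w (code p).
Proof. by move=> px; apply: eq_all => u; rewrite ext_in. Qed.

Lemma ext_box_out p u : (code (Box p) <= x) = false ->
  ext (Box p) u = if n <= m then ~~ (is_box p && ext_null p) else ext_valid p.
Proof. by move=> /= ->. Qed.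

(** Inside the fragment, coherence of [u] applies, subformulas having smaller codes; outside, [ext]
    computes the connectives. *)
Lemma teval_ext u phi : u < 2 ^ x.+1 -> bit w u -> teval (ext^~ u) phi = ext phi u.
Proof.
move=> lt_u w_u.
have /and5P[/all_worldsP/(_ u lt_u w_u)/andP[coh _] _ _ _ _] := model_w.
have /and3P[u0 /bforallP u_neg /bforallP u_or] := coh.
have le4 c : c <= 4 * c by rewrite leq_pmull.
elim: phi => [i||p IHp|p IHp q IHq|p IHp] //.
- by rewrite /= (negPf u0).
- rewrite [LHS]/= IHp /=; case: ifP => // px.
  have p_x : code p <= x by apply: leq_trans px; do 2!apply: leqW.
  by rewrite ext_in //; apply/esym/eqP; apply: implyP px; apply: u_neg.
- rewrite [LHS]/= IHp IHq /=; case: ifP => // px.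
  have pq_x : cpair (code p) (code q) <= x.
    by apply: leq_trans px; do 3!apply: leqW.
  have [p_x q_x] := leq_cpair (code p) (code q).
  have {}p_x := leq_trans p_x pq_x; have {}q_x := leq_trans q_x pq_x.
  rewrite !ext_in //; apply/esym/eqP; apply: implyP px.
  by have /bforallP := u_or _ p_x; apply.
Qed.

Section Inhabited.

Variable u0 : nat.
Hypotheses (lt_u0 : u0 < 2 ^ x.+1) (w_u0 : bit w u0).

(** The world [u0] matters: over no worlds, everything is both valid and null. *)
Lemma valid_not_null p : ext_valid p -> ext_null p -> False.
Proof.
by move=> /all_worldsP/(_ u0 lt_u0 w_u0) p_u0 /all_worldsP/(_ u0 lt_u0 w_u0)/negP.
Qed.

Lemma ext_nec p : ext_valid p -> ext_valid (Box p).
Proof.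
move=> val_p; case px: (code (Box p) <= x).
  have p_x : code p <= x := leq_trans (leq_cbox _) px.
  have /and5P[_ /bforallP nec _ _ _] := model_w.
  rewrite ext_valid_in // in val_p; rewrite ext_valid_in //.
  by have /implyP/(_ px)/implyP := nec _ p_x; apply.
apply/all_worldsP => u _ _; rewrite ext_box_out //; case: ifP => // _.
by apply/negP => /andP[_ /(valid_not_null val_p)].
Qed.

(** Outside the fragment, [ext] has this built in when n <= m; when m < n, a true [Box (Box p)]
    would make [Box p] valid as well as null. *)
Lemma ext_ros p : ext_null (Box p) -> ext_null (Box (Box p)).
Proof.
move=> null_p; case px: (code (Box (Box p)) <= x).
  have bp_x : code (Box p) <= x := leq_trans (leq_cbox _) px.
  have p_x : code p <= x := leq_trans (leq_cbox _) bp_x.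
  have /and5P[_ _ /bforallP ros _ _] := model_w.
  rewrite ext_null_in // in null_p; rewrite ext_null_in //.
  by have /implyP/(_ px)/implyP := ros _ p_x; apply.
apply/all_worldsP => u _ _; rewrite ext_box_out //.
case: ifP => _; first by rewrite negbK null_p.
by apply/negP => /valid_not_null; apply.
Qed.

(** Descends from k to j: outside the fragment a false box has a null argument; once inside,
    [null_closed] leads to j at once. *)
Lemma ext_null_closed p j k :
  n < m -> n <= j <= k -> ext_null (boxn k p) -> ext_null (boxn j p).
Proof.
move=> lt_nm; case/andP=> le_nj; elim: k => [|k IHk].
  by rewrite leqn0 => /eqP->.
rewrite leq_eqVlt ltnS => /predU1P[->//|le_jk] null_p.
case px: (code (boxn k.+1 p) <= x); last first.
  (* Outside the fragment a box has the same value at all worlds, so [u0] decides it. *)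
  apply: IHk => //; have /all_worldsP/(_ u0 lt_u0 w_u0) := null_p.
  by rewrite ext_box_out // ltnW // negbK => /andP[].
have jx : code (boxn j p) <= x.
  by apply: leq_trans px; rewrite !code_boxn leq_iter_cbox // ltnW.
have /and5P[_ _ _ /implyP/(_ lt_nm)/bforallP null_w _] := model_w.
rewrite ext_null_in // code_boxn in null_p; rewrite ext_null_in // code_boxn.
rewrite code_boxn in px.
have p_x : code p <= x := leq_trans (leq_iter_cbox _ (leq0n _)) px.
have k_x : k.+1 < x.+1 := leq_trans (geq_iter_cbox _ _) px.
have /bforallP/(_ _ k_x)/bforallP/(_ j le_jk) := null_w _ p_x.
by rewrite le_nj px null_p.
Qed.

(** Dual descent: outside the fragment a true box now has a valid argument. *)
Lemma ext_valid_closed p j k :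
  m < n -> m <= j <= k -> ext_valid (boxn k p) -> ext_valid (boxn j p).
Proof.
move=> lt_mn; case/andP=> le_mj; elim: k => [|k IHk].
  by rewrite leqn0 => /eqP->.
rewrite leq_eqVlt ltnS => /predU1P[->//|le_jk] val_p.
case px: (code (boxn k.+1 p) <= x); last first.
  apply: IHk => //; have /all_worldsP/(_ u0 lt_u0 w_u0) := val_p.
  by rewrite ext_box_out // leqNgt lt_mn.
have jx : code (boxn j p) <= x.
  by apply: leq_trans px; rewrite !code_boxn leq_iter_cbox // ltnW.
have /and5P[_ _ _ _ /implyP/(_ lt_mn)/bforallP val_w] := model_w.
rewrite ext_valid_in // code_boxn in val_p; rewrite ext_valid_in // code_boxn.
rewrite code_boxn in px.
have p_x : code p <= x := leq_trans (leq_iter_cbox _ (leq0n _)) px.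
have k_x : k.+1 < x.+1 := leq_trans (geq_iter_cbox _ _) px.
have /bforallP/(_ _ k_x)/bforallP/(_ j le_jk) := val_w _ p_x.
by rewrite le_mj px val_p.
Qed.

(** If the longer formula is in the fragment, so is the shorter, and [acc_at] applies. Otherwise a
    false [boxn m p] (n < m) has a null argument, a true [boxn n p] (m < n) a valid one, and descent
    along the chain reaches the shorter formula. *)
Lemma ext_acc p u : u < 2 ^ x.+1 -> bit w u ->
  ext (boxn n p) u -> ext (boxn m p) u.
Proof.
move=> lt_u w_u.
have in_case : code (boxn n p) <= x -> code (boxn m p) <= x ->
    ext (boxn n p) u -> ext (boxn m p) u.
  move=> nx mx; rewrite !ext_in //; rewrite !code_boxn in nx mx *.
  have /and5P[/all_worldsP/(_ u lt_u w_u)/andP[_ /bforallP acc] _ _ _ _] := model_w.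
  have p_x : code p <= x := leq_trans (leq_iter_cbox _ (leq0n _)) nx.
  by have := acc _ p_x; rewrite nx mx /= => /implyP.
case: (ltngtP n m) in_case => [lt_nm|lt_mn|-> //] in_case.
- case mx: (code (boxn m p) <= x).
    apply: in_case => //; apply: leq_trans mx.
    by rewrite !code_boxn leq_iter_cbox // ltnW.
  have def_m := ltn_predK lt_nm; rewrite -def_m in mx *.
  rewrite (ext_box_out (p := boxn m.-1 p)) // ltnW //.
  move=> n_u; apply/negP => /andP[_ null_m].
  have le_nm1 : n <= n <= m.-1 by rewrite leqnn -ltnS def_m.
  have /all_worldsP/(_ u lt_u w_u)/negP := ext_null_closed lt_nm le_nm1 null_m.
  exact.
- case nx: (code (boxn n p) <= x).
    apply: in_case => //; apply: leq_trans nx.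
    by rewrite !code_boxn leq_iter_cbox // ltnW.
  have def_n := ltn_predK lt_mn; rewrite -def_n in nx *.
  rewrite (ext_box_out (p := boxn n.-1 p)) // leqNgt lt_mn /= => val_n.
  have le_mn1 : m <= m <= n.-1 by rewrite leqnn -ltnS def_n.
  by have /all_worldsP/(_ u lt_u w_u) := ext_valid_closed lt_mn le_mn1 val_n.
Qed.

Lemma ext_sound p : NplusA m n p -> ext_valid p.
Proof.
have ext_imp q r u : u < 2 ^ x.+1 -> bit w u ->
    ext (Imp q r) u = (ext q u ==> ext r u).
  by move=> lt_u w_u; rewrite -teval_ext //= !teval_ext // implybE.
have ext_neg q : ext_valid (Neg q) = ext_null q.
  by apply/all_worldsP/all_worldsP => q_w u lt_u w_u; have := q_w u lt_u w_u;
     rewrite -!teval_ext.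
elim=> {p} [p taut_p|p|p q _ IHpq _ IHp|p _ IHp|p _ IHp].
- by apply/all_worldsP => u lt_u w_u; rewrite -teval_ext.
- by apply/all_worldsP => u lt_u w_u; rewrite ext_imp //; apply/implyP/ext_acc.
- apply/all_worldsP => u lt_u w_u.
  have := all_worldsP _ _ _ IHpq u lt_u w_u; rewrite ext_imp // => /implyP; apply.
  exact: (all_worldsP _ _ _ IHp).
- exact: ext_nec.
- by rewrite ext_neg; apply: ext_ros; rewrite -ext_neg.
Qed.

End Inhabited.

End Soundness.

Lemma NplusA_not_refuted m n psi : NplusA m n psi -> ~~ refuted m n (code psi).
Proof.
move=> prov; rewrite negbK; apply/bforallP => w _; apply/implyP => mod_w.
apply/all_worldsP => u lt_u w_u; rewrite -(@ext_in m n (code psi) w) //.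
(* The world under inspection itself shows that [w] is inhabited. *)
exact: (all_worldsP _ _ _ (ext_sound mod_w lt_u w_u prov)).
Qed.

(** * The canonical finite model *)

Definition decode a := sval (code_surj a).

Lemma decodeK : cancel decode code.
Proof. by move=> a; apply: svalP (code_surj a). Qed.

Lemma codeK : cancel code decode.
Proof. by move=> phi; apply: code_inj; rewrite decodeK. Qed.

Lemma decode_iter_cbox k a : decode (iter k cbox a) = boxn k (decode a).
Proof. by rewrite -[in LHS](decodeK a) -code_boxn codeK. Qed.

Lemma decode_cbox a : decode (cbox a) = Box (decode a).
Proof. exact: (decode_iter_cbox 1). Qed.

Lemma decode_cneg a : decode (cneg a) = Neg (decode a).
Proof. by apply: code_inj; rewrite /= !decodeK. Qed.

Lemma decode_cor a b : decode (cor a b) = Or (decode a) (decode b).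
Proof. by apply: code_inj; rewrite /= !decodeK. Qed.

(* The negation of the diagram of the valuation coded by [u]. *)
Definition differs x u :=
  foldr (fun a => Or (if bit u a then Neg (decode a) else decode a)) Bot
    (iota 0 x.+1).

Lemma teval_differs v x u :
  teval v (differs x u) = ~~ bforall x.+1 (fun a => bit u a == teval v (decode a)).
Proof.
rewrite /differs /bforall; elim: (iota 0 x.+1) => //= a s ->.
by rewrite negb_and; congr (_ || _); case: bit => //=; case: teval.
Qed.

Section Completeness.

Variables m n : nat.
Local Notation provable := (NplusA m n).

(** Closure under tautological consequence: by induction on N, a provable [theta N] becomes an
    antecedent discharged by modus ponens, and an unprovable one is dropped. *)
Lemma provable_consequence (theta : nat -> form) N phi :
  (forall v, (forall i, i < N -> provable (theta i) -> teval v (theta i)) ->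
    teval v phi) ->
  provable phi.
Proof.
elim: N phi => [|N IHN] phi phi_true.
  by apply: NplusA_taut => v; apply: phi_true.
have [prov_N|nprov_N] := classic (provable (theta N)).
  apply: NplusA_mp prov_N; apply: IHN => v theta_v /=; rewrite -implybE.
  apply/implyP => theta_N; apply: phi_true => i; rewrite ltnS leq_eqVlt.
  by case/predU1P=> [->//|]; apply: theta_v.
apply: IHN => v theta_v; apply: phi_true => i; rewrite ltnS leq_eqVlt.
by case/predU1P=> [->//|]; apply: theta_v.
Qed.

Lemma provable_imp phi psi :
  provable phi -> (forall v, teval v phi -> teval v psi) -> provable psi.
Proof.
move=> prov_phi phi_psi; apply: (@provable_consequence (fun=> phi) 1) => v.
by move=> /(_ 0 isT prov_phi) /phi_psi.
Qed.

(** The axiom for [boxn (j - m) phi] reduces the goal from j to the larger n + (j - m); once k is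
    reached, necessitation suffices. *)
Lemma provable_boxn_down j k phi :
  m < n -> m <= j -> provable (boxn k phi) -> provable (boxn j phi).
Proof.
move=> lt_mn le_mj prov_k.
have [N] := ubnP (k - j); elim: N j le_mj => // N IHN j le_mj lt_kj.
have [le_kj|lt_jk] := leqP k j.
  by rewrite -(subnK le_kj) /boxn iterD; elim: (j - k) => //= i /NplusA_nec.
have := NplusA_acc m n (boxn (j - m) phi); rewrite /boxn -!iterD subnKC //.
move/NplusA_mp; apply; apply: IHN.
  by rewrite (leq_trans (ltnW lt_mn)) ?leq_addr.
rewrite ltnS in lt_kj; apply: leq_trans lt_kj.
by rewrite ltn_sub2l // -{1}(subnKC le_mj) ltn_add2r.
Qed.

(** The contraposed axiom raises the goal from j to m + (j - n) until k is reached; from there Ros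
    suffices, as k > 0 makes its premise the negation of a box. *)
Lemma provable_neg_boxn_down j k phi :
  n < m -> n <= j -> 0 < k -> provable (Neg (boxn k phi)) ->
  provable (Neg (boxn j phi)).
Proof.
move=> lt_nm le_nj k_gt0 prov_k.
have [N] := ubnP (k - j); elim: N j le_nj => // N IHN j le_nj lt_kj.
have [le_kj|lt_jk] := leqP k j.
  rewrite -(subnK le_kj) /boxn iterD; elim: (j - k) => //= i.
  rewrite -iterD; case def_ik: (i + k) => [|l]; last exact: NplusA_rosbox.
  by move/eqP: def_ik; rewrite addn_eq0 (gtn_eqF k_gt0) andbF.
have acc := NplusA_acc m n (boxn (j - n) phi).
rewrite /boxn -!iterD subnKC // in acc.
have: provable (Neg (boxn (m + (j - n)) phi)).
  apply: IHN; first by rewrite (leq_trans (ltnW lt_nm)) ?leq_addr.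
  rewrite ltnS in lt_kj; apply: leq_trans lt_kj.
  by rewrite ltn_sub2l // -{1}(subnKC le_nj) ltn_add2r.
apply: NplusA_mp; apply: provable_imp acc _ => v /=.
by case: teval; case: teval.
Qed.

Section CanonicalModel.

Variables x w : nat.
Hypothesis w_consistent :
  forall u, u < 2 ^ x.+1 -> bit w u <-> ~ provable (differs x u).

(** Otherwise [theta] would tautologically imply [differs x u], making it provable. *)
Lemma world_realized u theta : u < 2 ^ x.+1 -> bit w u -> provable theta ->
  exists2 v, teval v theta & forall a, a <= x -> bit u a = teval v (decode a).
Proof.
move=> lt_u /(w_consistent lt_u) nprov prov_theta; apply: NNPP => no_v.
apply: nprov; apply: provable_imp prov_theta _ => v v_theta.
rewrite teval_differs; apply/negP => /bforallP agree; apply: no_v.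
by exists v => // a le_a; apply/eqP; apply: agree.
Qed.

(** Consequence of the provable [differs x u] with u < 2^(x+1): a valuation satisfying all of these
    restricts to a world. *)
Lemma provable_worlds phi :
  (forall v u, u < 2 ^ x.+1 -> bit w u ->
    (forall a, a <= x -> bit u a = teval v (decode a)) -> teval v phi) ->
  provable phi.
Proof.
move=> phi_worlds; apply: (@provable_consequence (differs x) (2 ^ x.+1)) => v v_diff.
have [u lt_u bit_u] := bits_exist (fun a => teval v (decode a)) x.+1.
have agree a : a <= x -> bit u a = teval v (decode a).
  by move=> le_a; apply/idP/idP => /bit_u; apply.
apply: (phi_worlds v u) => //; apply/(w_consistent lt_u) => prov_u.
have := v_diff u lt_u prov_u; rewrite teval_differs => /negP; apply.
by apply/bforallP => a le_a; apply/eqP/agree.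
Qed.

(** Truth lemma: it turns the closure conditions of [model] into rules of the logic. *)
Lemma valid_provable a : a <= x -> valid x w a <-> provable (decode a).
Proof.
move=> le_a; split=> [/all_worldsP val_a|prov_a].
  by apply: provable_worlds => v u lt_u w_u <- //; apply: val_a.
apply/all_worldsP => u lt_u w_u.
by have [v v_a ->] := world_realized lt_u w_u prov_a.
Qed.

Lemma null_provable a : a <= x -> null x w a <-> provable (Neg (decode a)).
Proof.
move=> le_a; split=> [/all_worldsP null_a|prov_a].
  by apply: provable_worlds => v u lt_u w_u /= <- //; apply: null_a.
apply/all_worldsP => u lt_u w_u.
by have [v v_a ->] := world_realized lt_u w_u prov_a.
Qed.

Lemma canonical_model : model m n x w.
Proof.
apply/and5P; split.
- apply/all_worldsP => u lt_u w_u; apply/andP; split.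
    have taut0 : provable (Neg Bot) by apply: NplusA_taut.
    have [v _ agree] := world_realized lt_u w_u taut0.
    apply/and3P; split.
    + by rewrite agree // (codeK Bot).
    + apply/bforallP => a le_a; apply/implyP => le_na.
      by rewrite !agree // decode_cneg.
    + apply/bforallP => a le_a; apply/bforallP => b le_b; apply/implyP => le_or.
      by rewrite !agree // decode_cor.
  apply/bforallP => a le_a; apply/implyP => le_m; apply/implyP => le_n.
  have [v v_acc agree] := world_realized lt_u w_u (NplusA_acc m n (decode a)).
  by rewrite !agree // !decode_iter_cbox implybE.
- apply/bforallP => a le_a; apply/implyP => le_ba; apply/implyP.
  move/(valid_provable le_a)/NplusA_nec => prov_ba.
  by apply/(valid_provable le_ba); rewrite decode_cbox.
- apply/bforallP => a le_a; apply/implyP => le_bba; apply/implyP.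
  have le_ba := leq_trans (leq_cbox _) le_bba.
  move/(null_provable le_ba); rewrite decode_cbox => /NplusA_rosbox prov_bba.
  by apply/(null_provable le_bba); rewrite !decode_cbox.
- apply/implyP => lt_nm; apply/bforallP => a _; apply/bforallP => k _.
  apply/bforallP => j lt_jk; apply/implyP => le_nj; apply/implyP => le_k.
  have le_j := leq_trans (leq_iter_cbox a (ltnW lt_jk)) le_k.
  apply/implyP => /(null_provable le_k); rewrite decode_iter_cbox => prov_k.
  apply/(null_provable le_j); rewrite decode_iter_cbox.
  exact: provable_neg_boxn_down lt_nm le_nj (leq_ltn_trans (leq0n j) lt_jk) prov_k.
- apply/implyP => lt_mn; apply/bforallP => a _; apply/bforallP => k _.
  apply/bforallP => j lt_jk; apply/implyP => le_mj; apply/implyP => le_k.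
  have le_j := leq_trans (leq_iter_cbox a (ltnW lt_jk)) le_k.
  apply/implyP => /(valid_provable le_k); rewrite decode_iter_cbox => prov_k.
  apply/(valid_provable le_j); rewrite decode_iter_cbox.
  exact: provable_boxn_down lt_mn le_mj prov_k.
Qed.

End CanonicalModel.

Lemma not_refuted_NplusA psi : ~~ refuted m n (code psi) -> provable psi.
Proof.
set x := code psi; rewrite negbK => /bforallP no_refutation.
have [w lt_w w_consistent] :=
  bits_exist (fun u => ~ provable (differs x u)) (2 ^ x.+1).
have := no_refutation w lt_w; rewrite (canonical_model w_consistent) => /=.
by move/(valid_provable w_consistent (leqnn x)); rewrite codeK.
Qed.

End Completeness.

(** * From the bounded search to decidability *)

Theorem corollary6p10 (m n : nat) : decidable_set (NplusA m n).
Proof.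
exists (fun v => ~~ refuted m n (thead v)).
  exact/rec_negb/rec_refuted/rec_head.
(* Every number is the code of a formula, so no separate test for codes arises. *)
move=> x; rewrite theadE; have [psi <-] := code_surj x.
split=> [[phi /code_inj-> /NplusA_not_refuted->] //|not_prov].
case: (boolP (~~ _)) => // /not_refuted_NplusA prov_psi.
by case: not_prov; exists psi.
Qed.
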